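(* Let $k$ be a level, $\kappa=k+2\ne0$. Let $J_\pm(z),J_0(z)$ be currents of $\widehat{\mathbf{sl}(2)}$ at level $k$, let $j(z)$ be a free current with $j(z)\cdot j(w)\sim-2\kappa/(z-w)^2$, let $\beta,\gamma$ be free bosons with $\beta(z)\cdot\gamma(w)\sim1/(z-w)$, and let $a_+,a^+,a_0,a^0,a_-,a^-$ be free fermions with $a_+(z)\cdot a^+(w)\sim a_0(z)\cdot a^0(w)\sim a_-(z)\cdot a^-(w)\sim1/(z-w)$; all other operator products among the fields $J_\pm,J_0$ / $j$ / $\beta,\gamma$ / fermions are regular. Put $$\begin{aligned} \mathsf G^+&=a^+\beta+a^0\bigl(\tfrac12(J_0+j)+a^-a_-\bigr)+a^-J_--\partial a^0,\\ \tau_{\mathsf R}\mathsf G^-&=(2\kappa)^{-1}\bigl(a_+(J_-+2\kappa\partial\gamma)+a_0(J_0-j+2a^-a_-)+a_-(2J_+-\beta)+a^0a_+a_-+2\partial a_0\bigr),\\ \mathsf J&=a^+a_++a^0a_0+a^-a_-,\\ \mathsf T&=\beta\partial\gamma+(4\kappa)^{-1}\bigl((J_0)^2+2J_+J_-+2J_-J_+-j^2-2\partial j\bigr)\\ &\quad+\tfrac12\bigl(\partial a^+a_++\partial a^0a_0+\partial a^-a_--a^+\partial a_+-a^0\partial a_0-a^-\partial a_-\bigr),\\ \Phi&=-\tfrac1{3\kappa^2}\,a_+a_0a_-,\\ \mathsf A&=\gamma(J_+-2a^-a_0+a^0a_+), \end{aligned}$$ and define the Wakimoto currents (at level $-k-4$)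 $$K_+=\beta,\qquad K_0=-2\gamma\beta+j,\qquad K_-=-\gamma^2\beta+\gamma j-(k+4)\partial\gamma.$$ Then $$\begin{aligned} e^{-\operatorname{ad}(\mathsf A)}\mathsf G^+&=a^+(J_++K_+)+a^0\bigl(\tfrac12(J_0+K_0)-a^+a_++a^-a_-\bigr)+a^-(J_-+K_-)-2a^+a^-a_0,\\ e^{-\operatorname{ad}(\mathsf A)}\tau_{\mathsf R}\mathsf G^-&=(2\kappa)^{-1}\bigl(a_+(J_--K_-)+a_0(J_0-K_0)+a_-(J_+-K_+)\bigr), \end{aligned}$$ while the fields $\mathsf J$, $\mathsf T$ and $\Phi$ are left invariant by the automorphism $e^{-\operatorname{ad}(\mathsf A)}$.
   Context: All products are normally ordered. $A(z)\cdot B(w)\sim\sum_{n>0}[AB]_n(w)/(z-w)^n$ is the singular part of the operator product. Currents of $\widehat{\mathbf{sl}(2)}$ at level $k$ satisfy $$J_+(z)\cdot J_-(w)\sim\frac k{(z-w)^2}+\frac{J_0(w)}{z-w},\quad J_0(z)\cdot J_\pm(w)\sim\pm\frac{2J_\pm(w)}{z-w},\quad J_0(z)\cdot J_0(w)\sim\frac{2k}{(z-w)^2},$$ and $J_\pm\cdot J_\pm\sim 0$. For the field $\mathsf A$ (of conformal dimension 1), $\operatorname{ad}(\mathsf A)X=[\mathsf AX]_1$ is the (graded) commutator with the zero mode of $\mathsf A$, and $e^{-\operatorname{ad}(\mathsf A)}X=\sum_{n\ge0}\frac{(-1)^n}{n!}\operatorname{ad}(\mathsf A)^nX$. The symbol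 $\tau_{\mathsf R}\mathsf G^-$ is the name of the field displayed in the claim (it arises as a twist by $\mathsf R=(2\kappa)^{-1}a_+a_-$). *)

(* Defs.v *)
From HB Require Import structures.
From mathcomp Require Import all_boot all_order all_algebra.

Set Implicit Arguments.
Unset Strict Implicit.
Unset Printing Implicit Defensive.

Import GRing.Theory.
Local Open Scope ring_scope.

(* The binomial coefficient m(m-1)...(m-j+1)/j! for a possibly negative m;
   only meaningful when F has characteristic 0. *)
Definition gbin (F : fieldType) (m : int) (j : nat) : F :=
  (\prod_(i < j) (m%:~R - i%:R)) / (j`!)%:R.

(* Operator product algebras are rendered as vertex superalgebras, a field A(z)
   being identified with the corresponding state A.  [nprod n a b] is the n-th
   product a_(n) b in the usual indexing, i.e. the coefficient of (z-w)^(-n-1)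
   in the operator product a(z) b(w).

   [borcherds] is the Borcherds (Jacobi) identity.  By [nprod_trunc] all its
   sums have finitely many nonzero terms, so the equality of the infinite sums
   is stated as the equality of all sufficiently long partial sums. *)
Record vertex_superalgebra (F : fieldType) := VertexSuperalgebra {
  va_space :> lmodType F;
  vac : va_space;
  nprod : int -> va_space -> va_space -> va_space;
  parity : bool -> va_space -> Prop; (* [parity true]: odd states *)
  parity0 : forall p, parity p 0;
  parity_linear : forall p (c : F) x y,
    parity p x -> parity p y -> parity p (c *: x + y);
  parity_split : forall x, exists x0 x1,
    [/\ parity false x0, parity true x1 & x = x0 + x1];
  parity_direct : forall x, parity false x -> parity true x -> x = 0;
  parity_vac : parity false vac;
  parity_nprod : forall p q n x y,
    parity p x -> parity q y -> parity (p (+) q) (nprod n x y);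
  nprod_linear_l : forall n (c : F) x x' y,
    nprod n (c *: x + x') y = c *: nprod n x y + nprod n x' y;
  nprod_linear_r : forall n (c : F) x y y',
    nprod n x (c *: y + y') = c *: nprod n x y + nprod n x y';
  nprod_trunc : forall x y, exists N : nat, forall n : nat,
    (N <= n)%N -> nprod n%:Z x y = 0;
  nprod_vac_l : forall n x, nprod n vac x = if n == -1 then x else 0;
  nprod_vac_r : forall x, nprod (-1) x vac = x;
  nprod_vac_r_ge0 : forall (n : nat) x, nprod n%:Z x vac = 0;
  borcherds : forall p q a b, parity p a -> parity q b ->
    forall c (l m n : int), exists N : nat, forall M : nat, (N <= M)%N ->
      \sum_(i < M) gbin F m i *:
         nprod (m + l - i%:Z) (nprod (n + i%:Z) a b) c
      = \sum_(i < M) ((-1) ^+ i * gbin F n i) *: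
          (nprod (m + n - i%:Z) a (nprod (l + i%:Z) b c)
           - ((-1) ^+ (p && q) * (-1) ^ n) *:
               nprod (n + l - i%:Z) b (nprod (m + i%:Z) a c))
}.

Arguments vac {F v}.
Arguments nprod {F v} n x y.
Arguments parity {F v} p x.

Section OperatorProducts.
Context {F : fieldType} {V : vertex_superalgebra F}.
Implicit Types (a b x y : V) (s : seq V).

(* [AB]_n, the coefficient of (z-w)^(-n) in A(z) B(w). *)
Definition opbr (n : int) a b : V := nprod (n - 1) a b.

Definition nop a b : V := opbr 0 a b.

Definition der a : V := opbr (-1) a vac.

(* a(z) b(w) ~ s_0(w)/(z-w) + s_1(w)/(z-w)^2 + ... ; [ope a b [::]] says that
   the operator product is regular. *)
Definition ope a b s : Prop := forall n : nat, opbr n.+1%:Z a b = s`_n.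

Definition mutually_regular s s' : Prop :=
  {in s & s', forall x y, ope x y [::] /\ ope y x [::]}.

Definition ad a x : V := opbr 1 a x.

(* The series e^(-ad a) x = sum_n (-1)^n/n! ad(a)^n x has finitely many nonzero
   terms, and its sum is y. *)
Definition exp_neg_ad_to a x y : Prop :=
  exists N : nat,
    (forall n : nat, (N <= n)%N -> iter n (ad a) x = 0) /\
    y = \sum_(n < N) ((-1) ^+ n / (n`!)%:R) *: iter n (ad a) x.

(* The vertex subalgebra generated by s. *)
Inductive generated s : V -> Prop :=
| generated_mem x : x \in s -> generated s x
| generated_vac : generated s vac
| generated_linear (c : F) x y :
    generated s x -> generated s y -> generated s (c *: x + y)
| generated_nprod n x y :
    generated s x -> generated s y -> generated s (nprod n x y).

(* phi restricts to an automorphism of the vertex subalgebra U. *)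
Record automorphism_on (U : V -> Prop) (phi : V -> V) : Prop :=
  AutomorphismOn {
  aut_stable : forall x, U x -> U (phi x);
  aut_linear : forall (c : F) x y, U x -> U y ->
    phi (c *: x + y) = c *: phi x + phi y;
  aut_vac : phi vac = vac;
  aut_nprod : forall n x y, U x -> U y ->
    phi (nprod n x y) = nprod n (phi x) (phi y);
  aut_parity : forall p x, U x -> parity p x -> parity p (phi x);
  aut_inj : forall x y, U x -> U y -> phi x = phi y -> x = y;
  aut_surj : forall y, U y -> exists2 x, U x & phi x = y
}.

End OperatorProducts.

(* Normally ordered product; iterated products are nested to the right,
   a ** b ** c = (a(bc)), which matters for gamma ** gamma ** beta. *)
Notation "a ** b" := (nop a b) (at level 37, right associativity) : ring_scope.

(* aLp, aL0, aLm are a_+, a_0, a_-; aUp, aU0, aUm are a^+, a^0, a^-. *)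
Record generators (F : fieldType) (V : vertex_superalgebra F) := Generators {
  Jp : V; J0 : V; Jm : V;
  jj : V;
  bet : V; gam : V;
  aLp : V; aL0 : V; aLm : V;
  aUp : V; aU0 : V; aUm : V
}.

Section Fields.
Context {F : fieldType} {V : vertex_superalgebra F}.
Variables (k : F) (g : generators V).

Definition kappa : F := k + 2.

Definition sl2_currents : seq V := [:: Jp g; J0 g; Jm g].
Definition lower_fermions : seq V := [:: aLp g; aL0 g; aLm g].
Definition upper_fermions : seq V := [:: aUp g; aU0 g; aUm g].
Definition fermions : seq V := lower_fermions ++ upper_fermions.
Definition bosons : seq V := sl2_currents ++ [:: jj g; bet g; gam g].
Definition all_generators : seq V := bosons ++ fermions.

Record generator_opes : Prop := GeneratorOpes {
  bosons_even : {in bosons, forall x, parity false x};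
  fermions_odd : {in fermions, forall x, parity true x};
  ope_JpJm : ope (Jp g) (Jm g) [:: J0 g; k *: vac];
  ope_J0Jp : ope (J0 g) (Jp g) [:: 2 *: Jp g];
  ope_J0Jm : ope (J0 g) (Jm g) [:: (- 2) *: Jm g];
  ope_J0J0 : ope (J0 g) (J0 g) [:: 0; (2 * k) *: vac];
  ope_JpJp : ope (Jp g) (Jp g) [::];
  ope_JmJm : ope (Jm g) (Jm g) [::];
  ope_jj : ope (jj g) (jj g) [:: 0; (- (2 * kappa)) *: vac];
  ope_betgam : ope (bet g) (gam g) [:: vac];
  ope_betbet : ope (bet g) (bet g) [::];
  ope_gamgam : ope (gam g) (gam g) [::];
  ope_aLpUp : ope (aLp g) (aUp g) [:: vac];
  ope_aL0U0 : ope (aL0 g) (aU0 g) [:: vac];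
  ope_aLmUm : ope (aLm g) (aUm g) [:: vac];
  reg_lower : mutually_regular lower_fermions lower_fermions;
  reg_upper : mutually_regular upper_fermions upper_fermions;
  reg_aLp : mutually_regular [:: aLp g] [:: aU0 g; aUm g];
  reg_aL0 : mutually_regular [:: aL0 g] [:: aUp g; aUm g];
  reg_aLm : mutually_regular [:: aLm g] [:: aUp g; aU0 g];
  reg_sl2_j : mutually_regular sl2_currents [:: jj g];
  reg_sl2_betgam : mutually_regular sl2_currents [:: bet g; gam g];
  reg_j_betgam : mutually_regular [:: jj g] [:: bet g; gam g];
  reg_bosons_fermions : mutually_regular bosons fermions
}.

Definition Gplus : V :=
  aUp g ** bet g
  + aU0 g ** (2^-1 *: (J0 g + jj g) + aUm g ** aLm g)
  + aUm g ** Jm g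
  - der (aU0 g).

Definition tauR_Gminus : V :=
  (2 * kappa)^-1 *:
    (aLp g ** (Jm g + (2 * kappa) *: der (gam g))
     + aL0 g ** (J0 g - jj g + 2 *: (aUm g ** aLm g))
     + aLm g ** (2 *: Jp g - bet g)
     + aU0 g ** aLp g ** aLm g
     + 2 *: der (aL0 g)).

Definition Jfield : V := aUp g ** aLp g + aU0 g ** aL0 g + aUm g ** aLm g.

Definition Tfield : V :=
  bet g ** der (gam g)
  + (4 * kappa)^-1 *:
      (J0 g ** J0 g + 2 *: (Jp g ** Jm g) + 2 *: (Jm g ** Jp g)
       - jj g ** jj g - 2 *: der (jj g))
  + 2^-1 *:
      (der (aUp g) ** aLp g + der (aU0 g) ** aL0 g + der (aUm g) ** aLm g
       - aUp g ** der (aLp g) - aU0 g ** der (aL0 g) - aUm g ** der (aLm g)).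

Definition Phi : V := (- (3 * kappa ^+ 2)^-1) *: (aLp g ** aL0 g ** aLm g).

Definition Afield : V :=
  gam g ** (Jp g - 2 *: (aUm g ** aL0 g) + aU0 g ** aLp g).

Definition Kp : V := bet g.
Definition K0 : V := (- 2) *: (gam g ** bet g) + jj g.
Definition Km : V :=
  - (gam g ** gam g ** bet g) + gam g ** jj g - (k + 4) *: der (gam g).

End Fields.

(* Main.v *)
(* [ad A] is a derivation of all n-products, by the Borcherds identity with m = 0.
   It is nilpotent on the generators, hence locally nilpotent on the subalgebra U
   they generate, and exp(-ad A) is therefore an automorphism of U with inverse
   exp(ad A).

   Write A = gamma X with X = J_+ - 2 a^- a_0 + a^0 a_+.  On every generator y but
   beta and J_- one has ad(A) y = gamma (X_(0) y), while ad(A) beta = - X and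
   ad(A) J_- = gamma J_0 + k der gamma.  With these values J, T and Phi are
   annihilated by ad(A), and on G^+ and tau_R G^- the series stops after the cubic
   term.  Its terms are compared as linear combinations of right-nested words in
   the generators; quasi-associativity of the normally ordered product is what
   produces the derivative terms, in particular the shift from k to k + 4 in the
   coefficient of der gamma. *)
Require Import Defs.
From HB Require Import structures.
From mathcomp Require Import all_boot all_order all_algebra.
From mathcomp Require Import zify ring boolp.

Set Implicit Arguments.
Unset Strict Implicit.
Unset Printing Implicit Defensive.

Import GRing.Theory.
Local Open Scope ring_scope.

(** * Characteristic zero and the generalized binomial coefficients *)

Lemma pchar0_natr_neq0 (F : fieldType) (charF : [pchar F] =i pred0) n :
  (n.+1)%:R != 0 :> F.
Proof. by move/pcharf0P: charF => ->. Qed.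

Lemma pchar0_fact_neq0 (F : fieldType) (charF : [pchar F] =i pred0) n :
  (n`!)%:R != 0 :> F.
Proof. by move/pcharf0P: charF => ->; rewrite -lt0n fact_gt0. Qed.

Section GeneralizedBinomial.
Context (F : fieldType).

Lemma gbinx0 m : gbin F m 0 = 1.
Proof. by rewrite /gbin big_ord0 fact0 divr1. Qed.

Lemma gbin0S j : gbin F 0 j.+1 = 0.
Proof. by rewrite /gbin big_ord_recl subrr !mul0r. Qed.

Lemma gbinN1 (charF : [pchar F] =i pred0) j : gbin F (-1) j = (-1) ^+ j.
Proof.
apply: (canLR (mulfK (pchar0_fact_neq0 charF j))).
elim: j => [|j IHj]; first by rewrite big_ord0 fact0 mulr1.
by rewrite big_ord_recr /= IHj factS natrM exprS mulrNz mulr1z -natr1; ring.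
Qed.
End GeneralizedBinomial.

(** * Consequences of the Borcherds identity *)

Section VertexAlgebra.
Context {F : fieldType} {V : vertex_superalgebra F}.
Implicit Types (a b c x y : V) (m n l : int) (p q : bool).

Lemma nprodDl n x x' y : nprod n (x + x') y = nprod n x y + nprod n x' y.
Proof. by have := nprod_linear_l n 1 x x' y; rewrite !scale1r. Qed.

Lemma nprodDr n x y y' : nprod n x (y + y') = nprod n x y + nprod n x y'.
Proof. by have := nprod_linear_r n 1 x y y'; rewrite !scale1r. Qed.

Lemma nprod0l n y : nprod n 0 y = 0 :> V.
Proof. by apply: (addIr (nprod n 0 y)); rewrite -nprodDl !add0r. Qed.

Lemma nprod0r n x : nprod n x 0 = 0.
Proof. by apply: (addIr (nprod n x 0)); rewrite -nprodDr !add0r. Qed.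

Lemma nprodZl n (s : F) x y : nprod n (s *: x) y = s *: nprod n x y.
Proof. by have := nprod_linear_l n s x 0 y; rewrite nprod0l !addr0. Qed.

Lemma nprodZr n (s : F) x y : nprod n x (s *: y) = s *: nprod n x y.
Proof. by have := nprod_linear_r n s x y 0; rewrite nprod0r !addr0. Qed.

Lemma nprodNl n x y : nprod n (- x) y = - nprod n x y.
Proof. by rewrite -scaleN1r nprodZl scaleN1r. Qed.

Lemma nprodNr n x y : nprod n x (- y) = - nprod n x y.
Proof. by rewrite -scaleN1r nprodZr scaleN1r. Qed.

Lemma nprod_suml n (I : Type) (r : seq I) (P : pred I) (f : I -> V) y :
  nprod n (\sum_(i <- r | P i) f i) y = \sum_(i <- r | P i) nprod n (f i) y.
Proof. by elim/big_rec2: _ => [|i u v _ <-]; rewrite ?nprod0l ?nprodDl. Qed.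

Lemma nprod_sumr n (I : Type) (r : seq I) (P : pred I) (f : I -> V) x :
  nprod n x (\sum_(i <- r | P i) f i) = \sum_(i <- r | P i) nprod n x (f i).
Proof. by elim/big_rec2: _ => [|i u v _ <-]; rewrite ?nprod0r ?nprodDr. Qed.

Lemma parityD p x y : parity p x -> parity p y -> parity p (x + y).
Proof. by move=> hx hy; have := parity_linear 1 hx hy; rewrite scale1r. Qed.

Lemma parityZ p (s : F) x : parity p x -> parity p (s *: x).
Proof. by move=> hx; have := parity_linear s hx (parity0 V p); rewrite addr0. Qed.

(* Applied to the sums of the Borcherds identity, r being a point beyond which
   all terms vanish. *)
Lemma sum_stable (f : nat -> V) r M : (r <= M)%N ->
  (forall i, (r <= i)%N -> f i = 0) -> \sum_(i < M) f i = \sum_(i < r) f i.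
Proof.
move=> le_rM f0; rewrite (big_ord_widen M f le_rM) [LHS](bigID (fun i : 'I_M => (i < r)%N)) /=.
by rewrite [X in _ + X]big1 ?addr0 // => i; rewrite -leqNgt => /f0.
Qed.

(** The axiom equates partial sums only beyond some unknown length. Once explicit points are known
    after which the terms vanish, both sides become sums of chosen length; [r] and [r'] differ
    because the two sides need not stop at the same index. *)
Lemma borcherds_bounded p q a b (pa : parity p a) (pb : parity q b) c l m n r r' :
  (forall i : nat, (r <= i)%N ->
    gbin F m i *: nprod (m + l - i%:Z) (nprod (n + i%:Z) a b) c = 0) ->
  (forall i : nat, (r' <= i)%N ->
    ((-1) ^+ i * gbin F n i) *:
      (nprod (m + n - i%:Z) a (nprod (l + i%:Z) b c)
       - ((-1) ^+ (p && q) * (-1) ^ n) *: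
           nprod (n + l - i%:Z) b (nprod (m + i%:Z) a c)) = 0) ->
  \sum_(i < r) gbin F m i *: nprod (m + l - i%:Z) (nprod (n + i%:Z) a b) c =
  \sum_(i < r') ((-1) ^+ i * gbin F n i) *:
    (nprod (m + n - i%:Z) a (nprod (l + i%:Z) b c)
     - ((-1) ^+ (p && q) * (-1) ^ n) *:
         nprod (n + l - i%:Z) b (nprod (m + i%:Z) a c)).
Proof.
move=> f0 g0; have [N /(_ (N + (r + r'))%N (leq_addr _ _)) eqN] :=
  borcherds pa pb c l m n.
have le_r : (r <= N + (r + r'))%N by rewrite addnCA leq_addr.
have le_r' : (r' <= N + (r + r'))%N by rewrite addnA leq_addl.
exact: etrans (esym (sum_stable le_r f0)) (etrans eqN (sum_stable le_r' g0)).
Qed.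

(** Commutator formula: the Borcherds identity with [n = 0], where the binomial coefficients on the
    right vanish for [i > 0]. *)
Lemma nprod_comm p q a b (pa : parity p a) (pb : parity q b) c m l r :
  (forall i : nat, (r <= i)%N -> nprod i a b = 0) ->
  nprod m a (nprod l b c) =
    (-1) ^+ (p && q) *: nprod l b (nprod m a c)
    + \sum_(i < r) gbin F m i *: nprod (m + l - i%:Z) (nprod i a b) c.
Proof.
move=> ab0; have := @borcherds_bounded p q a b pa pb c l m 0 r 1.
rewrite big_ord1 /= gbinx0 !mulr1 scale1r (_ : Posz 0 = 0) // oppr0 !addr0 !add0r.
under eq_bigr do rewrite add0r.
move=> ->; first by rewrite addrC subrK.
- by move=> i le_ri; rewrite add0r ab0 // nprod0l scaler0.
- by case=> // i _; rewrite gbin0S mulr0 scale0r.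
Qed.

(** Iterate formula: the Borcherds identity with [m = 0], which collapses the left side to its first
    term. *)
Lemma nprod_nprod p q a b (pa : parity p a) (pb : parity q b) c n l r :
  (forall i : nat, (r <= i)%N -> nprod (l + i%:Z) b c = 0) ->
  (forall i : nat, (r <= i)%N -> nprod i a c = 0) ->
  nprod l (nprod n a b) c =
    \sum_(i < r) ((-1) ^+ i * gbin F n i) *:
      (nprod (n - i%:Z) a (nprod (l + i%:Z) b c)
       - ((-1) ^+ (p && q) * (-1) ^ n) *: nprod (n + l - i%:Z) b (nprod i a c)).
Proof.
move=> bc0 ac0; have := @borcherds_bounded p q a b pa pb c l 0 n 1 r.
rewrite big_ord1 /= gbinx0 scale1r (_ : Posz 0 = 0) // oppr0 !addr0 !add0r => ->.
- by under eq_bigr => i _ do rewrite !add0r.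
- by case=> // i _; rewrite gbin0S scale0r.
- by move=> i le_ri; rewrite !add0r bc0 // ac0 // !nprod0r scaler0 subrr scaler0.
Qed.

(** Skew-symmetry, from the Borcherds identity with [c = vac], [l = 0], [m = -1]: on the right only
    [b_(n) a_(-1) vac = b_(n) a] survives. The operation [nprod (-1 - i) _ vac] plays the part of
    the i-th divided power of the derivative. *)
Lemma nprod_skew (charF : [pchar F] =i pred0) p q a b
    (pa : parity p a) (pb : parity q b) n r :
  (forall i : nat, (r <= i)%N -> nprod (n + i%:Z) a b = 0) ->
  nprod n b a = - ((-1) ^+ (p && q) * (-1) ^ n) *:
    \sum_(i < r) (-1) ^+ i *: nprod (-1 - i%:Z) (nprod (n + i%:Z) a b) vac.
Proof.
move=> ab0; have := @borcherds_bounded p q a b pa pb vac 0 (-1) n r 1.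
rewrite big_ord1 /= gbinx0 mulr1 scale1r (_ : Posz 0 = 0) // oppr0 !addr0.
rewrite (nprod_vac_r_ge0 0) nprod0r sub0r nprod_vac_r => eq_sum.
under eq_bigr => i _ do rewrite -gbinN1 //.
have /eq_sum -> : forall i : nat, (r <= i)%N ->
    gbin F (-1) i *: nprod (-1 - i%:Z) (nprod (n + i%:Z) a b) vac = 0.
- by move=> i le_ri; rewrite ab0 // nprod0l scaler0.
- rewrite scalerN scaleNr opprK scalerA.
  have sgn2 : (-1) ^ n * (-1) ^ n = 1 :> F by rewrite -expfzMl mulrNN mulr1 exp1rz.
  by rewrite mulrACA sgn2 -signr_addb addbb mul1r scale1r.
case=> // i _; rewrite add0r nprod_vac_r_ge0.
have -> : -1 + i.+1%:Z = i%:Z by rewrite -addn1 PoszD addrC addrK.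
by rewrite nprod_vac_r_ge0 !nprod0r scaler0 subrr scaler0.
Qed.

Definition regular a b := forall n : nat, nprod n a b = 0.

Lemma regular_swap p q a b (pa : parity p a) (pb : parity q b) :
  regular a b -> forall m n c,
  nprod m a (nprod n b c) = (-1) ^+ (p && q) *: nprod n b (nprod m a c).
Proof.
by move=> ab0 m n c; rewrite (@nprod_comm p q a b pa pb c m n 0) ?big_ord0 ?addr0.
Qed.

(** The Borcherds identity is stated for homogeneous states; additive properties reduce to these. *)
Lemma parity_ind (P : V -> Prop) :
  (forall p x, parity p x -> P x) -> (forall x y, P x -> P y -> P (x + y)) ->
  forall x, P x.
Proof.
by move=> Pp PD x; have [x0 [x1 [/Pp P0 /Pp P1 ->]]] := parity_split x; exact: PD.
Qed.

Lemma nopE a b : nop a b = nprod (-1) a b. Proof. by []. Qed.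

Lemma derE a : der a = nprod (-2) a vac. Proof. by []. Qed.

Lemma nprod_vac_neq n x : n <> -1 -> nprod n vac x = 0.
Proof. by move/eqP/negbTE=> n_neq; rewrite nprod_vac_l n_neq. Qed.

Lemma nprod_der a c : nprod (-1) (der a) c = nprod (-2) a c.
Proof.
rewrite derE; elim/parity_ind: a => [p a pa|a a' IHa IHa']; last first.
  by rewrite !nprodDl IHa IHa'.
have [r ac0] := nprod_trunc a c.
(* The length is [r.+1] so that the term [i = 0], the only one to survive, is present even when
   [r = 0]. *)
rewrite (@nprod_nprod p false a vac pa (parity_vac V) c (-2) (-1) r.+1).
- rewrite big_ord_recl big1 => [|i _].
    by rewrite gbinx0 !nprod_vac_l /= scaler0 subr0 mulr1 scale1r addr0.
  rewrite !nprod_vac_neq ?nprod0r ?scaler0 ?subr0 ?scaler0 //= /bump /=; lia.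
- by move=> i i_gt; rewrite nprod_vac_neq //; lia.
- by move=> i /ltnW; exact: ac0.
Qed.

(** * Exponentials of locally nilpotent derivations *)

Section Derivation.
Context (A : V) (A_even : parity false A).

Lemma ad_nprod n x y : ad A (nprod n x y) = nprod n (ad A x) y + nprod n x (ad A y).
Proof.
have adE z : ad A z = nprod 0 A z by [].
rewrite !adE; elim/parity_ind: x => [p x px|x x' IHx IHx']; last first.
  by rewrite !(nprodDl, nprodDr) IHx IHx' addrACA.
have [r Ax0] := nprod_trunc A x.
rewrite (@nprod_comm _ _ _ _ A_even px y 0 n r.+1) => [|i /ltnW]; last exact: Ax0.
rewrite big_ord_recl big1 => [|i _]; last by rewrite gbin0S scale0r.
by rewrite gbinx0 !scale1r addr0 subr0 add0r addrC.
Qed.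

Lemma adZ (s : F) x : ad A (s *: x) = s *: ad A x. Proof. exact: nprodZr. Qed.
Lemma adD x y : ad A (x + y) = ad A x + ad A y. Proof. exact: nprodDr. Qed.
Lemma adN x : ad A (- x) = - ad A x. Proof. exact: nprodNr. Qed.
Lemma ad0 : ad A 0 = 0. Proof. exact: nprod0r. Qed.
Lemma ad_vac : ad A vac = 0. Proof. exact: nprod_vac_r_ge0 0%N A. Qed.

Lemma ad_nop x y : ad A (x ** y) = ad A x ** y + x ** ad A y.
Proof. exact: ad_nprod. Qed.

Lemma ad_der x : ad A (der x) = der (ad A x).
Proof. by rewrite !derE ad_nprod ad_vac nprod0r addr0. Qed.

Lemma ad_sum (I : Type) (r : seq I) (P : pred I) (f : I -> V) :
  ad A (\sum_(i <- r | P i) f i) = \sum_(i <- r | P i) ad A (f i).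
Proof. exact: nprod_sumr. Qed.

Definition ad_nilpotent x := exists N, iter N (ad A) x = 0.

Lemma iter_ad0 (n : nat) : iter n (ad A) 0 = 0.
Proof. by elim: n => //= n ->; exact: ad0. Qed.

Lemma iter_ad_eq0 x (N n : nat) : iter N (ad A) x = 0 -> (N <= n)%N -> iter n (ad A) x = 0.
Proof. by move=> x0 /subnK <-; rewrite iterD x0 iter_ad0. Qed.

Lemma iter_adZ (n : nat) (s : F) x : iter n (ad A) (s *: x) = s *: iter n (ad A) x.
Proof. by elim: n => //= n ->; exact: adZ. Qed.

Lemma iter_adD (n : nat) x y : iter n (ad A) (x + y) = iter n (ad A) x + iter n (ad A) y.
Proof. by elim: n => //= n ->; exact: adD. Qed.

Context (charF : [pchar F] =i pred0).

(** * Divided powers and the exponential series *)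

Definition dpow_ad (t : F) (n : nat) x := (t ^+ n / (n`!)%:R) *: iter n (ad A) x.

Lemma dpow_ad0 t x : dpow_ad t 0 x = x.
Proof. by rewrite /dpow_ad fact0 divr1 scale1r. Qed.

Lemma dpow_adS t (n : nat) x : n.+1%:R *: dpow_ad t n.+1 x = t *: ad A (dpow_ad t n x).
Proof.
rewrite /dpow_ad adZ !scalerA /=; congr (_ *: _).
have := pchar0_fact_neq0 charF n; have := pchar0_natr_neq0 charF n.
by rewrite factS natrM exprS => n0 f0; field; rewrite f0 addrC natr1.
Qed.

Lemma scalerSI (n : nat) x y : n.+1%:R *: x = n.+1%:R *: y -> x = y :> V.
Proof. exact: scalerI (pchar0_natr_neq0 charF n) _ _. Qed.

Lemma dpow_ad_nprod t (n : nat) m x y :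
  dpow_ad t n (nprod m x y) =
  \sum_(i < n.+1) nprod m (dpow_ad t i x) (dpow_ad t (n - i) y).
Proof.
elim: n => [|n IHn]; first by rewrite big_ord1 !dpow_ad0.
apply: (@scalerSI n); rewrite dpow_adS IHn ad_sum scaler_sumr.
(* The factor [n.+1] is split as [i + (n.+1 - i)]. After a shift of index the first part collects
   the terms where [ad A] acts on the left factor, the second those where it acts on the right
   one. *)
transitivity (\sum_(i < n.+2) (i%:R *: nprod m (dpow_ad t i x) (dpow_ad t (n.+1 - i) y)
  + (n.+1 - i)%:R *: nprod m (dpow_ad t i x) (dpow_ad t (n.+1 - i) y))).
  rewrite big_split /= [X in _ = X + _]big_ord_recl scale0r add0r.
  rewrite [X in _ = _ + X]big_ord_recr /= subnn scale0r addr0 -big_split /=.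
  apply: eq_bigr => i _; rewrite ad_nprod scalerDr -nprodZl -nprodZr -!dpow_adS.
  by rewrite nprodZl nprodZr -subSn ?leq_ord // subSS.
rewrite scaler_sumr; apply: eq_bigr => i _.
by rewrite -scalerDl -natrD subnKC // leq_ord.
Qed.

Lemma dpow_adM t s (n : nat) x :
  dpow_ad (t + s) n x = \sum_(i < n.+1) dpow_ad t i (dpow_ad s (n - i) x).
Proof.
rewrite /dpow_ad addrC exprDn mulr_suml scaler_suml.
apply: eq_bigr => i _; rewrite iter_adZ -iterD subnKC ?leq_ord // scalerA.
congr (_ *: _); have := pchar0_fact_neq0 charF n.
rewrite -(bin_fact (leq_ord i)) !natrM !mulf_eq0 !negb_or => /and3P[C0 f0 g0].
by rewrite -mulr_natr; field; rewrite C0 f0 g0.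
Qed.


(** The antidiagonals of index below [N + M] cover the N by M rectangle, and [f] vanishes outside
    it. This is the rearrangement behind both the multiplicativity of the exponential and its
    additivity in [t]. *)
Lemma Cauchy_product (f : nat -> nat -> V) N M :
  (forall i j, (N <= i)%N || (M <= j)%N -> f i j = 0) ->
  \sum_(n < N + M) \sum_(i < n.+1) f i (n - i)%N = \sum_(i < N) \sum_(j < M) f i j.
Proof.
move=> f0; transitivity (\sum_(i < N + M) \sum_(j < N + M - i) f i j).
  transitivity (\sum_(n < N + M) \sum_(i < N + M | (i < n.+1)%N) f i (n - i)%N).
    by apply: eq_bigr => n _; rewrite (big_ord_widen (N + M) (fun i => f i (n - i)%N)).
  rewrite (exchange_big_dep xpredT) //=; apply: eq_bigr => i _.
  rewrite -(big_mkord (fun n : nat => i < n.+1)%N (fun n : nat => f i (n - i)%N)).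
  rewrite (big_cat_nat (n := i)) //= ?(ltnW (ltn_ord i)) //.
  rewrite big_nat_cond big1 ?add0r => [|n]; last first.
    by rewrite ltnS => /andP[/andP[_ ni] /(leq_trans ni)]; rewrite ltnn.
  rewrite -{1}[nat_of_ord i]add0n big_addn big_mkord.
  by apply: eq_big => [n|n _]; rewrite ?addnK // ltnS leq_addl.
rewrite (sum_stable (r := N) (f := fun i => \sum_(j < N + M - i) f i j)) ?leq_addr //.
  apply: eq_bigr => i _; apply: (sum_stable (f := f i)) => [|j Mj].
    by rewrite addnC -addnBA ?leq_addr // ltnW.
  by rewrite f0 // Mj orbT.
by move=> i Ni; rewrite big1 // => j _; rewrite f0 // Ni.
Qed.

Lemma dpow_ad_eq0 t x (N n : nat) :
  iter N (ad A) x = 0 -> (N <= n)%N -> dpow_ad t n x = 0.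
Proof. by move=> x0 Nn; rewrite /dpow_ad (iter_ad_eq0 x0 Nn) scaler0. Qed.

Lemma dpow_ad_linear t (n : nat) s x y :
  dpow_ad t n (s *: x + y) = s *: dpow_ad t n x + dpow_ad t n y.
Proof. by rewrite /dpow_ad iter_adD iter_adZ scalerDr !scalerA mulrC. Qed.

Lemma nilpotent_linear s x y :
  ad_nilpotent x -> ad_nilpotent y -> ad_nilpotent (s *: x + y).
Proof.
move=> [N x0] [M y0]; exists (N + M)%N.
by rewrite iter_adD iter_adZ (iter_ad_eq0 x0) ?leq_addr // (iter_ad_eq0 y0)
  ?leq_addl // scaler0 addr0.
Qed.

Lemma nilpotent_nprod m x y :
  ad_nilpotent x -> ad_nilpotent y -> ad_nilpotent (nprod m x y).
Proof.
move=> [N x0] [M y0]; exists (N + M)%N.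
(* In the Leibniz sum for this divided power each term has at least [N] derivations on [x] or at
   least [M] on [y]; in characteristic 0 the factorial can be removed. *)
suff: dpow_ad 1 (N + M) (nprod m x y) = 0.
  move/eqP; rewrite /dpow_ad scaler_eq0 expr1n mul1r invr_eq0.
  by rewrite (negbTE (pchar0_fact_neq0 charF _)) => /eqP.
rewrite dpow_ad_nprod big1 // => i _; have [le_Ni | lt_iN] := leqP N i.
  by rewrite (dpow_ad_eq0 _ x0) // nprod0l.
by rewrite (dpow_ad_eq0 _ y0) ?nprod0r //; lia.
Qed.

(** The number of terms of the series depends on [x]. Excluded middle and choice fix one bound for
    each state, so that the exponential is a total function on [V]. *)
Lemma nilpotency_bound_subproof x :
  exists N : nat, ad_nilpotent x -> iter N (ad A) x = 0.
Proof.
by have [[N x0]|] := EM (ad_nilpotent x); [exists N | exists 0%N].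
Qed.

Definition nilpotency_bound : V -> nat := projT1 (choice nilpotency_bound_subproof).

(* A meaningless partial sum if ad A is not nilpotent at x. *)
Definition exp_ad t x := \sum_(n < nilpotency_bound x) dpow_ad t n x.

(** Any valid bound gives the same sum, so the chosen one may be forgotten from here on. *)
Lemma exp_adE t x (N : nat) :
  iter N (ad A) x = 0 -> exp_ad t x = \sum_(n < N) dpow_ad t n x.
Proof.
move=> x0; have /(_ (ex_intro _ N x0)) x0' := projT2 (choice nilpotency_bound_subproof) x.
rewrite /exp_ad -/nilpotency_bound in x0' *; set M := nilpotency_bound x in x0' *.
have le_M := leq_addl N M; have le_N := leq_addr M N.
rewrite -(sum_stable (f := dpow_ad t ^~ x) le_M) => [|i Mi]; last exact: dpow_ad_eq0 Mi.
by rewrite (sum_stable (f := dpow_ad t ^~ x) le_N) // => i Ni; exact: dpow_ad_eq0 Ni.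
Qed.

Lemma exp_ad_linear t s x y : ad_nilpotent x -> ad_nilpotent y ->
  exp_ad t (s *: x + y) = s *: exp_ad t x + exp_ad t y.
Proof.
move=> [N x0] [M y0].
have x0' := iter_ad_eq0 x0 (leq_addr M N); have y0' := iter_ad_eq0 y0 (leq_addl N M).
rewrite (exp_adE t x0') (exp_adE t y0') (@exp_adE _ _ (N + M)).
  by rewrite scaler_sumr -big_split; apply: eq_bigr => n _; exact: dpow_ad_linear.
by rewrite iter_adD iter_adZ x0' y0' scaler0 addr0.
Qed.

Lemma exp_ad_vac t : exp_ad t vac = vac.
Proof. by rewrite (@exp_adE _ _ 1) ?big_ord1 ?dpow_ad0 //= ad_vac. Qed.

Lemma exp_ad_nprod t m x y : ad_nilpotent x -> ad_nilpotent y ->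
  exp_ad t (nprod m x y) = nprod m (exp_ad t x) (exp_ad t y).
Proof.
move=> x_nil y_nil; have [P xy0] := nilpotent_nprod m x_nil y_nil.
case: x_nil y_nil => [N x0] [M y0].
(* The bound for [x] is enlarged by [P] so that the Cauchy product, of length [P + N + M], also
   exceeds the bound [P] for the product. *)
have x0' := iter_ad_eq0 x0 (leq_addl P N).
rewrite (exp_adE t x0') (exp_adE t y0) (@exp_adE _ _ (P + N + M)); last first.
  by rewrite (iter_ad_eq0 xy0) // -addnA leq_addr.
under eq_bigr do rewrite dpow_ad_nprod.
rewrite (Cauchy_product (N := (P + N)%N)
  (f := fun i j => nprod m (dpow_ad t i x) (dpow_ad t j y))).
  by rewrite nprod_suml; apply: eq_bigr => i _; rewrite nprod_sumr.
move=> i j /orP[] le_ij; first by rewrite (dpow_ad_eq0 _ x0' le_ij) nprod0l.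
by rewrite (dpow_ad_eq0 _ y0 le_ij) nprod0r.
Qed.

Lemma exp_adD t s x : ad_nilpotent x -> exp_ad (t + s) x = exp_ad t (exp_ad s x).
Proof.
move=> [N x0]; have iter_exp (n : nat) :
    iter n (ad A) (exp_ad s x) = \sum_(i < N) iter n (ad A) (dpow_ad s i x).
  by rewrite (exp_adE s x0); elim: n => //= k ->; exact: ad_sum.
rewrite (@exp_adE t (exp_ad s x) N); last first.
  rewrite iter_exp big1 // => i _.
  by rewrite iter_adZ -iterD addnC iterD x0 iter_ad0 scaler0.
rewrite (@exp_adE (t + s) x (N + N)); last by rewrite iterD x0 iter_ad0.
under eq_bigr do rewrite dpow_adM.
rewrite (Cauchy_product (N := N) (M := N)
  (f := fun i j => dpow_ad t i (dpow_ad s j x))).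
  by apply: eq_bigr => i _; rewrite [RHS]/dpow_ad iter_exp scaler_sumr.
move=> i j le_ij; rewrite /dpow_ad iter_adZ -iterD (iter_ad_eq0 x0) ?scaler0 //; lia.
Qed.

Lemma exp_ad_0 x : ad_nilpotent x -> exp_ad 0 x = x.
Proof.
case=> N x0; rewrite (@exp_adE _ _ N.+1) ?(iter_ad_eq0 x0) // big_ord_recl.
by rewrite big1 ?dpow_ad0 ?addr0 // => i _; rewrite /dpow_ad expr0n mul0r scale0r.
Qed.

Lemma exp_ad_fixed t x : ad A x = 0 -> exp_ad t x = x.
Proof. by move=> Dx; rewrite (@exp_adE t x 1) // big_ord1 dpow_ad0. Qed.

Lemma exp_neg_ad_order4 x x1 x2 x3 :
  ad A x = x1 -> ad A x1 = x2 -> ad A x2 = x3 -> ad A x3 = 0 ->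
  exp_ad (-1) x = x - x1 + 2^-1 *: x2 - 6^-1 *: x3.
Proof.
move=> Dx Dx1 Dx2 Dx3; rewrite (@exp_adE (-1) x 4) /= ?Dx ?Dx1 ?Dx2 //.
rewrite !big_ord_recr big_ord0 /= /dpow_ad /= Dx Dx1 Dx2 add0r.
rewrite (_ : 0`! = 1)%N // (_ : 1`! = 1)%N // (_ : 2`! = 2)%N // (_ : 3`! = 6)%N // !divr1.
rewrite expr0 expr1 sqrrN expr1n (exprS _ 2) sqrrN expr1n.
by rewrite !mulr1 !mul1r mulN1r !scaleNr !scale1r.
Qed.

Lemma exp_neg_ad_toP x : ad_nilpotent x -> exp_neg_ad_to A x (exp_ad (-1) x).
Proof.
by case=> N x0; exists N; split=> [n|]; [exact: iter_ad_eq0 | exact: exp_adE].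
Qed.

Lemma parity_exp_ad p t x : parity p x -> parity p (exp_ad t x).
Proof.
move=> px; apply: (big_ind (parity p)) => [|y z|i _]; [exact: parity0|exact: parityD|].
apply: parityZ; elim: (nat_of_ord i) => //= n IHn.
exact: (parity_nprod 0 A_even IHn).
Qed.

(** * Restriction to a generated vertex subalgebra *)

Section Generated.
Context (s : seq V) (A_gen : generated s A).
Hypothesis s_nil : {in s, forall x, ad_nilpotent x}.

Lemma generated_nilpotent x : generated s x -> ad_nilpotent x.
Proof.
elim=> [y /s_nil //||c y z _ IHy _ IHz|n y z _ IHy _ IHz].
- by exists 1; rewrite /= ad_vac.
- exact: nilpotent_linear.
- exact: nilpotent_nprod.
Qed.

Lemma generated0 : generated s 0.
Proof.
rewrite -(addNr vac) -scaleN1r.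
by apply: generated_linear; exact: generated_vac.
Qed.

Lemma generated_exp_ad t x : generated s x -> generated s (exp_ad t x).
Proof.
move=> gx; rewrite /exp_ad; apply: big_ind => [|y z gy gz|i _]; first exact: generated0.
  by rewrite -[y]scale1r; exact: generated_linear.
rewrite /dpow_ad -[_ *: _]addr0; apply: generated_linear; last exact: generated0.
by elim: (nat_of_ord i) => //= n; exact: generated_nprod.
Qed.

Lemma exp_ad_automorphism t : automorphism_on (generated s) (exp_ad t).
Proof.
have expK u v x : u + v = 0 -> generated s x -> exp_ad u (exp_ad v x) = x.
  by move=> uv /generated_nilpotent x_nil; rewrite -exp_adD // uv exp_ad_0.
split=> [|c x y /generated_nilpotent gx /generated_nilpotent gy
        ||n x y /generated_nilpotent gx /generated_nilpotent gy
        |p x _|x y gx gy eq_xy|y gy].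
- exact: generated_exp_ad.
- exact: exp_ad_linear.
- exact: exp_ad_vac.
- exact: exp_ad_nprod.
- exact: parity_exp_ad.
- by rewrite -[x](expK (- t) t) ?addNr // eq_xy expK ?addNr.
- by exists (exp_ad (- t) y); [exact: generated_exp_ad | rewrite expK ?addrN].
Qed.
End Generated.

End Derivation.
End VertexAlgebra.

(** * Comparison of linear combinations *)

Section LinearCombinations.
Context {F : fieldType} {V : lmodType F}.

(** Syntax for proof by reflection: vectors are positions in an environment, while scalars stay
    terms of [F], to be compared later by [ring] or [field]. *)
Inductive lexp :=
  | LVar of nat | LZero | LAdd of lexp & lexp | LOpp of lexp | LScale of F & lexp.

Fixpoint leval (env : seq V) e : V :=
  match e with
  | LVar i => env`_i
  | LZero => 0
  | LAdd e1 e2 => leval env e1 + leval env e2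
  | LOpp e1 => - leval env e1
  | LScale c e1 => c *: leval env e1
  end.

Fixpoint lcoef e (i : nat) : F :=
  match e with
  | LVar j => if i == j then 1 else 0
  | LZero => 0
  | LAdd e1 e2 => lcoef e1 i + lcoef e2 i
  | LOpp e1 => - lcoef e1 i
  | LScale c e1 => c * lcoef e1 i
  end.

Lemma levalE env e : leval env e = \sum_(i < size env) lcoef e i *: env`_i.
Proof.
elim: e => [j||e1 IH1 e2 IH2|e IH|c e IH] /=; last first.
- by rewrite IH scaler_sumr; apply: eq_bigr => i _; rewrite scalerA.
- by rewrite IH -sumrN; apply: eq_bigr => i _; rewrite scaleNr.
- by rewrite IH1 IH2 -big_split; apply: eq_bigr => i _; rewrite scalerDl.
- by rewrite big1 // => i _; rewrite scale0r.
have [lt_j | le_j] := ltnP j (size env); last first.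
  rewrite nth_default // big1 // => i _; case: eqP => [ij|]; last by rewrite scale0r.
  by have := ltn_ord i; rewrite ij ltnNge le_j.
rewrite (bigD1 (Ordinal lt_j)) //= eqxx scale1r big1 ?addr0 // => i.
by rewrite -val_eqE /= => /negbTE ->; rewrite scale0r.
Qed.

(** The hypothesis is a finite conjunction, one scalar equation per atom, so that it computes and
    splits. It is only a sufficient condition, the atoms not being assumed independent. *)
Lemma leval_eq env e1 e2 :
  foldr and True [seq lcoef e1 i = lcoef e2 i | i <- iota 0 (size env)] ->
  leval env e1 = leval env e2.
Proof.
move=> eq12; rewrite !levalE; apply: eq_bigr => -[i /= lt_i] _; congr (_ *: _).
have : i \in iota 0 (size env) by rewrite mem_iota.
by elim: (iota _ _) eq12 => //= j r IHr [eqj /IHr eqr]; rewrite in_cons => /predU1P[->|].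
Qed.
End LinearCombinations.

Ltac lindex x env :=
  lazymatch env with
  | x :: _ => constr:(0%N)
  | _ :: ?env' => let i := lindex x env' in constr:(i.+1)
  end.

Ltac latoms e env :=
  lazymatch e with
  | ?a + ?b => let env' := latoms a env in latoms b env'
  | - ?a => latoms a env
  | _ *: ?a => latoms a env
  | 0 => env
  | _ => lazymatch env with
         | context [e :: _] => env
         | _ => constr:(e :: env)
         end
  end.

Ltac lreify F e env :=
  lazymatch e with
  | ?a + ?b => let a' := lreify F a env in let b' := lreify F b env in
               constr:(LAdd a' b')
  | - ?a => let a' := lreify F a env in constr:(LOpp a')
  | ?c *: ?a => let a' := lreify F a env in constr:(LScale c a')
  | 0 => constr:(@LZero F)
  | _ => let i := lindex e env in constr:(@LVar F i)
  end.

(** Atoms are compared syntactically; words must therefore be in normal form beforehand. *)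
Ltac lincomb F V :=
  lazymatch goal with
  | |- ?lhs = ?rhs =>
    let env0 := latoms lhs (@nil V) in
    let env := latoms rhs env0 in
    let e1 := lreify F lhs env in
    let e2 := lreify F rhs env in
    change (leval env e1 = leval env e2);
    apply: leval_eq; repeat split; rewrite /lcoef /=
  end.

(** * Simple poles and normally ordered products *)

Section Contractions.
Context {F : fieldType} {V : vertex_superalgebra F}.
Implicit Types (a b c d x y : V) (p q : bool).

Lemma nopDl a b c : (a + b) ** c = a ** c + b ** c. Proof. exact: nprodDl. Qed.
Lemma nopDr a b c : a ** (b + c) = a ** b + a ** c. Proof. exact: nprodDr. Qed.
Lemma nopNl a b : (- a) ** b = - (a ** b). Proof. exact: nprodNl. Qed.
Lemma nopNr a b : a ** (- b) = - (a ** b). Proof. exact: nprodNr. Qed.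
Lemma nopZl (s : F) a b : (s *: a) ** b = s *: (a ** b). Proof. exact: nprodZl. Qed.
Lemma nopZr (s : F) a b : a ** (s *: b) = s *: (a ** b). Proof. exact: nprodZr. Qed.
Lemma nop0l a : 0 ** a = 0. Proof. exact: nprod0l. Qed.
Lemma nop0r a : a ** 0 = 0. Proof. exact: nprod0r. Qed.
Lemma nopv a : a ** vac = a. Proof. exact: nprod_vac_r. Qed.
Lemma derD a b : der (a + b) = der a + der b. Proof. exact: nprodDl. Qed.
Lemma derN a : der (- a) = - der a. Proof. exact: nprodNl. Qed.
Lemma derZ (s : F) a : der (s *: a) = s *: der a. Proof. exact: nprodZl. Qed.
Lemma der0 : der (0 : V) = 0. Proof. exact: nprod0l. Qed.

Lemma parity_nop p q a b : parity p a -> parity q b -> parity (p (+) q) (a ** b).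
Proof. exact: parity_nprod. Qed.

Lemma parity_der p a : parity p a -> parity p (der a).
Proof. by move=> pa; rewrite -[p]addbF; exact: parity_nprod pa (parity_vac V). Qed.

(* The operator product a(z) b(w) ~ d(w)/(z-w). *)
Definition contracts a b d :=
  nprod 0 a b = d /\ forall n : nat, nprod n.+1%:Z a b = 0.

Lemma opbrS (n : nat) a b : opbr n.+1%:Z a b = nprod n%:Z a b.
Proof. by rewrite /opbr -addn1 PoszD addrK. Qed.

Lemma ope_regular a b : ope a b [::] -> regular a b.
Proof. by move=> ab n; rewrite -opbrS ab nth_nil. Qed.

Lemma ope_contracts a b d : ope a b [:: d] -> contracts a b d.
Proof.
by move=> ab; split=> [|n]; [exact: (ab 0%N) | rewrite -opbrS ab /= nth_nil].
Qed.

Lemma regular_contracts a b : regular a b -> contracts a b 0.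
Proof. by move=> ab; split=> [|n]; [exact: (ab 0%N) | exact: ab]. Qed.

Lemma contracts0_regular a b : contracts a b 0 -> regular a b.
Proof. by case=> ab0 abS [|n]; [exact: ab0 | exact: abS]. Qed.

Lemma contractsD a b b' d d' :
  contracts a b d -> contracts a b' d' -> contracts a (b + b') (d + d').
Proof.
by move=> [e h] [e' h']; split=> [|n]; rewrite nprodDr ?e ?e' // h h' addr0.
Qed.

Lemma contractsZ (s : F) a b d : contracts a b d -> contracts a (s *: b) (s *: d).
Proof. by move=> [e h]; split=> [|n]; rewrite nprodZr ?e // h scaler0. Qed.

Lemma contractsN a b d : contracts a b d -> contracts a (- b) (- d).
Proof. by rewrite -!scaleN1r; exact: contractsZ. Qed.

Lemma contractsDl a a' b d d' :
  contracts a b d -> contracts a' b d' -> contracts (a + a') b (d + d').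
Proof.
by move=> [e h] [e' h']; split=> [|n]; rewrite nprodDl ?e ?e' // h h' addr0.
Qed.

Lemma contractsZl (s : F) a b d : contracts a b d -> contracts (s *: a) b (s *: d).
Proof. by move=> [e h]; split=> [|n]; rewrite nprodZl ?e // h scaler0. Qed.

Lemma contractsNl a b d : contracts a b d -> contracts (- a) b (- d).
Proof. by rewrite -!scaleN1r; exact: contractsZl. Qed.

(** With only a simple pole, skew-symmetry has no derivative terms. *)
Lemma contracts_sym (charF : [pchar F] =i pred0) p q a b d
    (pa : parity p a) (pb : parity q b) :
  contracts a b d -> contracts b a (- (-1) ^+ (p && q) *: d).
Proof.
move=> [ab0 abS]; split=> [|n].
  rewrite (nprod_skew charF pa pb (r := 1)) => [|[//|i] _]; last by rewrite add0r.
  by rewrite big_ord1 /= subr0 addr0 ab0 nprod_vac_r expr0z mulr1 !scale1r.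
rewrite (nprod_skew charF pa pb (r := 0)) ?big_ord0 ?scaler0 // => i _.
by rewrite -PoszD addSn.
Qed.

Lemma regularD a b b' : regular a b -> regular a b' -> regular a (b + b').
Proof. by move=> ab ab' n; rewrite nprodDr ab ab' addr0. Qed.

Lemma regularZ (s : F) a b : regular a b -> regular a (s *: b).
Proof. by move=> ab n; rewrite nprodZr ab scaler0. Qed.

Lemma regularN a b : regular a b -> regular a (- b).
Proof. by move=> ab n; rewrite nprodNr ab oppr0. Qed.

Lemma regular_nprod p q m a b c (pa : parity p a) (pb : parity q b) :
  regular a b -> regular a c -> regular a (nprod m b c).
Proof.
by move=> ab ac n; rewrite (regular_swap pa pb ab) ac nprod0r scaler0.
Qed.

Lemma regular0 a : regular a 0. Proof. by move=> n; exact: nprod0r. Qed.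

Lemma regular_vac a : regular a vac. Proof. by move=> n; exact: nprod_vac_r_ge0. Qed.

Lemma nprod_nop p q m a b w (pa : parity p a) (pb : parity q b) : regular a b ->
  nprod m a (b ** w) = (-1) ^+ (p && q) *: (b ** nprod m a w).
Proof. by move=> ab; rewrite !nopE (regular_swap pa pb ab). Qed.

Lemma contracts_nop p q a b c d (pa : parity p a) (pb : parity q b) :
  regular a b -> contracts a c d ->
  contracts a (b ** c) ((-1) ^+ (p && q) *: (b ** d)).
Proof.
move=> ab [ac0 acS]; split=> [|n]; rewrite (nprod_nop _ _ pa pb ab) ?ac0 //.
by rewrite acS nop0r scaler0.
Qed.

(** Wick's rule: besides passing through [b], the field [a] may contract with [b], which leaves [c].
    Higher poles stay absent since the nonnegative modes of the vacuum are zero. *)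
Lemma contracts_nop_dual p q a b c d (pa : parity p a) (pb : parity q b) :
  contracts a b vac -> contracts a c d ->
  contracts a (b ** c) ((-1) ^+ (p && q) *: (b ** d) + c).
Proof.
move=> [ab0 abS] [ac0 acS]; split=> [|n].
  rewrite !nopE (@nprod_comm _ _ p q a b pa pb _ _ _ 1) => [|[//|i] _]; last exact: abS.
  by rewrite big_ord1 gbinx0 scale1r ab0 ac0 nprod_vac_l.
rewrite !nopE (@nprod_comm _ _ p q a b pa pb _ _ _ 1) => [|[//|i] _]; last exact: abS.
rewrite big_ord1 gbinx0 scale1r ab0 acS nprod0r scaler0 add0r nprod_vac_neq //=.
Qed.

Context (charF : [pchar F] =i pred0).

(** Quasi-associativity. Simple poles stop the iterate formula after [i = 1]; beyond the
    right-nested word there remain [a_(-2) e] and [b_(-2) d], which are the two derivative terms. *)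
Lemma nop_nop p q a b c d e (pa : parity p a) (pb : parity q b) :
  contracts a c d -> contracts b c e ->
  (a ** b) ** c =
    a ** (b ** c) + der a ** e + (-1) ^+ (p && q) *: (der b ** d).
Proof.
move=> [ac0 acS] [bc0 bcS]; rewrite !nopE !nprod_der.
rewrite (@nprod_nprod _ _ p q a b pa pb c (-1) (-1) 2); last first.
- by case=> [|[|i]] // _; exact: acS.
- by case=> [|[|i]] // _; exact: bcS.
rewrite !big_ord_recl big_ord0 /= /bump /= !gbinN1 // ac0 -bc0 (acS 0%N) nprod0r.
rewrite scaler0 subr0 addr0 !expr0 !expr1 mulrNN !mulr1 !scale1r addrAC.
rewrite exprN1 invrN1 mulrN1 scaleNr opprK.
by rewrite subr0 addr0.
Qed.

Lemma nprod0_nop p q a b c d e (pa : parity p a) (pb : parity q b) :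
  contracts a c d -> contracts b c e ->
  nprod 0 (a ** b) c = a ** e + (-1) ^+ (p && q) *: (b ** d).
Proof.
move=> [ac0 acS] [bc0 bcS]; rewrite !nopE.
rewrite (@nprod_nprod _ _ p q a b pa pb c (-1) 0 1); last first.
- by case=> [|i] // _; exact: acS.
- by case=> [|i] // _; exact: bcS.
rewrite !big_ord_recl big_ord0 /= !gbinN1 // ac0 -bc0.
rewrite addr0 !expr0 mulr1 !scale1r.
by rewrite exprN1 invrN1 mulrN1 scaleNr opprK.
Qed.

(** Regularity of [b] with [d] rules out double contractions, which would create higher poles. *)
Lemma contracts_nopl p q a b c d e (pa : parity p a) (pb : parity q b) :
  contracts a c d -> contracts b c e -> regular b d ->
  contracts (a ** b) c (a ** e + (-1) ^+ (p && q) *: (b ** d)).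
Proof.
move=> acd bce bd; split=> [|n]; first exact: nprod0_nop.
case: acd bce => [ac0 acS] [bc0 bcS]; rewrite !nopE.
rewrite (@nprod_nprod _ _ p q a b pa pb c (-1) n.+1 1); last first.
- by case=> [|i] // _; exact: acS.
- by case=> [|i] // _; rewrite -PoszD addSn; exact: bcS.
rewrite !big_ord_recl big_ord0 /= addr0 ac0 addr0 bcS nprod0r sub0r oppr0 addr0.
have -> : -1 + n.+1%:Z = n%:Z by lia.
by rewrite bd scaler0 oppr0 scaler0.
Qed.

Lemma ad_nop_even a b y d e (pa : parity false a) (pb : parity false b) :
  contracts a y d -> contracts b y e -> ad (a ** b) y = a ** e + b ** d.
Proof. by move=> ay be; rewrite -[b ** d]scale1r; exact: (nprod0_nop pa pb). Qed.

Lemma nop_swap_even q a b w (pa : parity false a) (pb : parity q b) :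
  regular a b -> b ** (a ** w) = a ** (b ** w).
Proof. by move=> ab; rewrite [RHS](nprod_nop _ _ pa pb ab) scale1r. Qed.

Lemma nop_swap_der q a b w (pa : parity false a) (pb : parity q b) :
  regular a b -> b ** (der a ** w) = der a ** (b ** w).
Proof.
move=> ab; have derE' u : der a ** u = nprod (-2) a u := nprod_der a u.
by rewrite !derE' (nprod_nop _ _ pa pb ab) scale1r.
Qed.

(** The commutator of the modes of index -1 is a multiple of [vac_(-2) = 0], so dual fermions can be
    exchanged inside a word at no more cost than a sign. *)
Lemma nop_swap p q a b s w (pa : parity p a) (pb : parity q b) :
  contracts a b (s *: vac) -> a ** (b ** w) = (-1) ^+ (p && q) *: (b ** (a ** w)).
Proof.
case=> ab0 abS; rewrite !nopE (@nprod_comm _ _ p q a b pa pb w _ _ 1).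
  by rewrite big_ord1 ab0 nprodZl nprod_vac_neq // !scaler0 addr0.
by case=> [|i] // _; exact: abS.
Qed.

Lemma nop_comm p q a b s (pa : parity p a) (pb : parity q b) :
  contracts a b (s *: vac) -> a ** b = (-1) ^+ (p && q) *: (b ** a).
Proof. by move=> ab; rewrite -{1}(nopv b) (nop_swap vac pa pb ab) nopv. Qed.

Lemma nop_comm_der q a b (pa : parity false a) (pb : parity q b) :
  regular a b -> b ** der a = der a ** b.
Proof.
by move=> ab; rewrite -[in RHS](nopv b) -(nop_swap_der _ pa pb ab) nopv.
Qed.

(** The mode anticommutes with itself, and 2 is invertible. *)
Lemma nop_sqr_odd a w (pa : parity true a) : regular a a -> a ** (a ** w) = 0.
Proof.
move=> aa; have := nop_swap (s := 0) w pa pa.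
rewrite scale0r scaleN1r => /(_ (regular_contracts aa))/eqP.
rewrite -subr_eq0 opprK -mulr2n -scaler_nat scaler_eq0.
by rewrite (negbTE (pchar0_natr_neq0 charF 1)) => /eqP.
Qed.

Lemma nop_sqr_odd0 a (pa : parity true a) : regular a a -> a ** a = 0.
Proof. by move=> aa; rewrite -{2}(nopv a) nop_sqr_odd. Qed.

Lemma der_nop p q a b (pa : parity p a) (pb : parity q b) :
  der (a ** b) = der a ** b + a ** der b.
Proof.
rewrite !nopE nprod_der [LHS]derE (derE b).
rewrite (@nprod_nprod _ _ p q a b pa pb vac (-1) (-2) 2); last first.
- by move=> i _; exact: regular_vac.
- by case=> [|[|i]] // _; exact: regular_vac.
rewrite !big_ord_recl big_ord0 /= /bump /= !gbinN1 // addr0.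
rewrite (nprod_vac_r_ge0 0) (nprod_vac_r_ge0 1) !nprod0r !scaler0 !subr0.
rewrite expr0 mulr1 -exprMn mulrNN mulr1 expr1n !scale1r addr0 addrC.
by congr (nprod _ _ _ + _); exact: nprod_vac_r.
Qed.

Lemma regular_sym p q a b (pa : parity p a) (pb : parity q b) :
  regular a b -> regular b a.
Proof.
move/regular_contracts/(contracts_sym charF pa pb); rewrite scaler0.
exact: contracts0_regular.
Qed.

Lemma regular_derl p q a b (pa : parity p a) (pb : parity q b) :
  regular a b -> regular (der a) b.
Proof.
move/(regular_sym pa pb) => ba; apply: (regular_sym pb (parity_der pa)).
exact: regular_nprod pb pa ba (regular_vac b).
Qed.
End Contractions.

Lemma mutually_regularl (F : fieldType) (V : vertex_superalgebra F) (s s' : seq V) x y :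
  mutually_regular s s' -> x \in s -> y \in s' -> regular x y.
Proof. by move=> reg xs ys; have [/ope_regular] := reg x y xs ys. Qed.

Lemma mutually_regularr (F : fieldType) (V : vertex_superalgebra F) (s s' : seq V) x y :
  mutually_regular s s' -> x \in s -> y \in s' -> regular y x.
Proof. by move=> reg xs ys; have [_ /ope_regular] := reg x y xs ys. Qed.

(** * The derivation ad A *)

Section Wakimoto.
Context {F : fieldType} (charF : [pchar F] =i pred0) (k : F).
Context {V : vertex_superalgebra F} (g : generators V) (hg : generator_opes k g).

Local Notation jp := (Jp g).
Local Notation j0 := (J0 g).
Local Notation jm := (Jm g).
Local Notation jc := (jj g).
Local Notation bt := (bet g).
Local Notation gm := (gam g).
Local Notation lp := (aLp g).
Local Notation l0 := (aL0 g).
Local Notation lm := (aLm g).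
Local Notation up := (aUp g).
Local Notation u0 := (aU0 g).
Local Notation um := (aUm g).
Local Notation D := (ad (Afield g)).

(** * Automatic parities, regularity and contractions *)

Ltac mem := by rewrite /bosons /fermions /sl2_currents /lower_fermions
  /upper_fermions ?mem_cat !inE !eqxx ?orbT.

Ltac par :=
  lazymatch goal with
  | |- parity _ (der _) => apply: parity_der; par
  | |- parity _ (nop _ _) => apply: parity_nop; par
  | |- _ => solve [apply: (bosons_even hg); mem | apply: (fermions_odd hg); mem]
  end.

Ltac mutreg h := solve [apply: (mutually_regularl h); mem
                       |apply: (mutually_regularr h); mem].

Ltac reg :=
  lazymatch goal with
  | |- regular _ (_ + _) => apply: regularD; reg
  | |- regular _ (- _) => apply: regularN; reg
  | |- regular _ (_ *: _) => apply: regularZ; reg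
  | |- regular _ 0 => exact: regular0
  | |- regular _ vac => exact: regular_vac
  | |- regular (der _) _ => apply: (regular_derl charF); [par | par | reg]
  | |- regular _ (der _) =>
      apply: regular_nprod; [par | par | reg | exact: regular_vac]
  | |- regular _ (nop _ _) => apply: regular_nprod; [par | par | reg | reg]
  | |- _ =>
    first [ mutreg (reg_bosons_fermions hg) | mutreg (reg_sl2_betgam hg)
          | mutreg (reg_lower hg) | mutreg (reg_upper hg)
          | mutreg (reg_aLp hg) | mutreg (reg_aL0 hg) | mutreg (reg_aLm hg)
          | mutreg (reg_sl2_j hg) | mutreg (reg_j_betgam hg)
          | exact: (ope_regular (ope_JpJp hg)) | exact: (ope_regular (ope_JmJm hg))
          | exact: (ope_regular (ope_betbet hg)) | exact: (ope_regular (ope_gamgam hg)) ]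
  end.

Lemma contracts_dual (a b : V) : parity true a -> parity true b ->
  ope a b [:: vac] -> contracts b a vac.
Proof.
move=> pa pb /ope_contracts/(contracts_sym charF pa pb).
by rewrite scaleNr scaleN1r opprK.
Qed.

Ltac atom_contr :=
  first [ apply: regular_contracts; reg
        | exact: (ope_contracts (ope_aLpUp hg)) | exact: (ope_contracts (ope_aL0U0 hg))
        | exact: (ope_contracts (ope_aLmUm hg))
        | apply: (@contracts_dual lp up); [par | par | exact: (ope_aLpUp hg)]
        | apply: (@contracts_dual l0 u0); [par | par | exact: (ope_aL0U0 hg)]
        | apply: (@contracts_dual lm um); [par | par | exact: (ope_aLmUm hg)]
        | exact: (ope_contracts (ope_J0Jp hg)) | exact: (ope_contracts (ope_J0Jm hg))
        | apply: (contracts_sym charF _ _ (ope_contracts (ope_J0Jp hg))); par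
        | apply: (contracts_sym charF _ _ (ope_contracts (ope_betgam hg))); par ].

(** Recursion on the two fields by Wick's rule. The contraction may be left as an existential
    variable, so it is computed rather than guessed. Only simple poles are covered. *)
Ltac contr :=
  lazymatch goal with
  | |- contracts (_ + _) _ _ => apply: contractsDl; contr
  | |- contracts (- _) _ _ => apply: contractsNl; contr
  | |- contracts (_ *: _) _ _ => apply: contractsZl; contr
  | |- contracts _ (_ + _) _ => apply: contractsD; contr
  | |- contracts _ (- _) _ => apply: contractsN; contr
  | |- contracts _ (_ *: _) _ => apply: contractsZ; contr
  | |- contracts (nop _ _) _ _ =>
      apply: (contracts_nopl charF); [par | par | contr | contr | reg]
  | |- contracts _ (nop _ _) _ =>
      first [ apply: contracts_nop; [par | par | reg | contr]
            | apply: contracts_nop_dual; [par | par | atom_contr | contr] ]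
  | |- _ => atom_contr
  end.

Lemma parity_gam : parity false gm. Proof. by par. Qed.

(** Together with [nop_gam_bet] this right-nests words starting with [gm ** a]: if [c] is regular
    with [gm] the correction differentiates [gm], while for [c = bt] the contraction [- vac]
    differentiates [a] instead. *)
Lemma nop_gam q a c d : parity q a -> regular gm c -> contracts a c d ->
  (gm ** a) ** c = gm ** (a ** c) + der gm ** d.
Proof.
move=> pa reg_c ac;
rewrite (nop_nop charF parity_gam pa (regular_contracts reg_c) ac).
by rewrite nop0r scaler0 addr0.
Qed.

Lemma contracts_gam_bet : contracts gm bt (- vac).
Proof.
have pb : parity false bt by par.
rewrite -scaleN1r.
exact: (contracts_sym charF pb parity_gam (ope_contracts (ope_betgam hg))).
Qed.

Lemma nop_gam_bet q a : parity q a -> regular a bt ->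
  (gm ** a) ** bt = gm ** (a ** bt) - der a.
Proof.
move=> pa /regular_contracts reg_c.
rewrite (nop_nop charF parity_gam pa contracts_gam_bet reg_c).
by rewrite nop0r addr0 scale1r nopNr nopv.
Qed.

(** * Values of [ad A] on the generators *)

Definition Xfield := jp - 2 *: (um ** l0) + u0 ** lp.
Local Notation X := Xfield.

Lemma parity_X : parity false X.
Proof.
have pp : parity false jp by par.
have p1 : parity (true (+) true) (um ** l0) by par.
have p2 : parity (true (+) true) (u0 ** lp) by par.
by rewrite /X -scaleNr; apply: parityD (p2); apply: parityD (pp) _; exact: parityZ.
Qed.
Lemma AfieldE : Afield g = gm ** X. Proof. by []. Qed.

Lemma parity_Afield : parity false (Afield g).
Proof. exact: parity_nop parity_gam parity_X. Qed.

Lemma ad_generator y e : regular gm y -> contracts X y e -> D y = gm ** e.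
Proof.
move=> /regular_contracts gy Xy.
by rewrite AfieldE (ad_nop_even charF parity_gam parity_X gy Xy) nop0r addr0.
Qed.

Ltac ad_table :=
  etransitivity;
  [ apply: ad_generator; [reg | rewrite /X; contr]
  | rewrite !(nop0l, nop0r, nopv, scaler0, addr0, add0r, nopDr, nopNr, nopZr) /=;
    lincomb F (va_space V); ring ].

Lemma ad_up : D up = gm ** u0. Proof. ad_table. Qed.
Lemma ad_u0 : D u0 = - 2 *: (gm ** um). Proof. ad_table. Qed.
Lemma ad_um : D um = 0. Proof. ad_table. Qed.
Lemma ad_lp : D lp = 0. Proof. ad_table. Qed.
Lemma ad_l0 : D l0 = - (gm ** lp). Proof. ad_table. Qed.
Lemma ad_lm : D lm = 2 *: (gm ** l0). Proof. ad_table. Qed.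
Lemma ad_jp : D jp = 0. Proof. ad_table. Qed.
Lemma ad_j0 : D j0 = - 2 *: (gm ** jp). Proof. ad_table. Qed.
Lemma ad_jc : D jc = 0. Proof. ad_table. Qed.
Lemma ad_gm : D gm = 0. Proof. ad_table. Qed.

Definition nop_simpl :=
  (@nop0l F V, @nop0r F V, @nopv F V, @der0 F V, @scaler0 F V, @addr0 V, @add0r V,
   @oppr0 V, @subr0 V, @sub0r V).

Lemma ad_bt : D bt = - X.
Proof.
have Xb : contracts X bt 0.
  eassert (c : contracts X bt _) by (rewrite /X; contr).
  by rewrite !nop_simpl in c.
rewrite AfieldE (ad_nop_even charF parity_gam parity_X contracts_gam_bet Xb).
by rewrite nop0r add0r nopNr nopv.
Qed.

Lemma ad_jm : D jm = gm ** j0 + k *: der gm.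
Proof.
have jpjm (n : nat) : nprod n jp jm = [:: j0; k *: vac]`_n by rewrite -opbrS (ope_JpJm hg).
have Pjm : regular (- 2 *: (um ** l0) + u0 ** lp) jm.
  apply: contracts0_regular.
  eassert (c : contracts (- 2 *: (um ** l0) + u0 ** lp) jm _) by contr.
  by rewrite !nop_simpl in c.
have Xjm (n : nat) : nprod n X jm = [:: j0; k *: vac]`_n.
  by rewrite /X -addrA -scaleNr nprodDl Pjm addr0.
have gjm : regular gm jm by reg.
have -> : D jm = nprod 0 (nprod (-1) gm X) jm by [].
(* [X] and [jm] have a double pole, inherited from [jp], so two terms are needed; the term [i = 1]
   is [gm_(-2) (k vac)], whence [k *: der gm]. *)
rewrite (@nprod_nprod _ _ _ _ gm X parity_gam parity_X jm (-1) 0 2); last first.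
- by move=> i _; exact: gjm.
- by case=> [|[|i]] // _; rewrite add0r Xjm /= nth_nil.
rewrite !big_ord_recl big_ord0 /= /bump /= !gbinN1 // !gjm !nprod0r scaler0 !subr0.
rewrite add0r (Xjm 0%N) (Xjm 1%N) /= nprodZr addr0 -!exprMn mulrNN mulr1 !expr1n !scale1r.
by [].
Qed.

Definition adE := (@ad_nop F V _ parity_Afield, @ad_der F V _ parity_Afield,
  @adD F V, @adN F V, @adZ F V, @ad0 F V, ad_up, ad_u0, ad_um, ad_lp, ad_l0, ad_lm,
  ad_jp, ad_j0, ad_jm, ad_jc, ad_gm, ad_bt).

Definition linE := (nop_simpl, @nopDl F V, @nopDr F V, @nopNl F V, @nopNr F V,
  @nopZl F V, @nopZr F V, @derD F V, @derN F V, @derZ F V).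

Lemma regular_scal0 (a b : V) : regular a b -> contracts a b ((0 : F) *: vac).
Proof. by rewrite scale0r; exact: regular_contracts. Qed.

Lemma contracts_scal1 (a b : V) : contracts a b vac -> contracts a b ((1 : F) *: vac).
Proof. by rewrite scale1r. Qed.

Ltac scal := first [apply: regular_scal0; reg | apply: contracts_scal1; atom_contr].

(* Normal form of a word: gamma, then its derivative, then the fermions by
   increasing rank, then the currents. *)
Ltac rank x :=
  lazymatch x with
  | aUp _ => constr:(0%N) | aU0 _ => constr:(1%N) | aUm _ => constr:(2%N)
  | aLp _ => constr:(3%N) | aL0 _ => constr:(4%N) | aLm _ => constr:(5%N)
  end.

Ltac out_of_order x y :=
  let rx := rank x in let ry := rank y in
  let b := eval vm_compute in (ry < rx)%N in lazymatch b with true => idtac end.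

Ltac not_gam x := lazymatch x with gam _ => fail | der (gam _) => fail | _ => idtac end.

Ltac simp := rewrite ?linE /=.

Lemma nop_der_gam q r a c : parity q a -> parity r c ->
  regular gm c -> regular a c -> (der gm ** a) ** c = der gm ** (a ** c).
Proof.
move=> pa pc reg_gc /regular_contracts reg_ac.
have /regular_contracts reg_dc := regular_derl charF parity_gam pc reg_gc.
rewrite (nop_nop charF (parity_der parity_gam) pa reg_dc reg_ac).
by rewrite !nop0r scaler0 !addr0.
Qed.

(** One rewriting step towards the normal form. Left-nested words headed by [gm] or [der gm] are
    opened before any sorting, and the case of [bt] precedes the general one, which needs [gm]
    regular with the right factor. *)
Ltac nop_step :=
  match goal with
  | |- context [nop (nop (der gm) ?a) ?c] =>
    rewrite (@nop_der_gam _ _ a c ltac:(par) ltac:(par) ltac:(reg) ltac:(reg)); simp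
  | |- context [nop (nop gm ?a) bt] =>
    rewrite (@nop_gam_bet _ a ltac:(par) ltac:(reg)); simp
  | |- context [nop (nop gm ?a) ?c] =>
    let H := fresh "E" in
    eassert (H : nop (nop gm a) c = gm ** (a ** c) + der gm ** _)
      by (apply: nop_gam; [par | reg | contr]);
    rewrite {}H; simp
  | |- context [der (nop ?a ?b)] =>
    rewrite (@der_nop F V charF _ _ a b ltac:(par) ltac:(par)); simp
  | |- context [nop ?x (nop gm ?w)] =>
    lazymatch x with gam _ => fail | _ => idtac end;
    rewrite (@nop_swap_even F V _ gm x w parity_gam ltac:(par) ltac:(reg))
  | |- context [nop ?x (nop (der gm) ?w)] =>
    not_gam x;
    rewrite (@nop_swap_der F V _ gm x w parity_gam ltac:(par) ltac:(reg))
  | |- context [nop ?x (der gm)] =>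
    not_gam x;
    rewrite (@nop_comm_der F V _ gm x parity_gam ltac:(par) ltac:(reg))
  | |- context [nop ?x (nop ?x ?w)] =>
    not_gam x;
    rewrite (@nop_sqr_odd F V charF x w ltac:(par) ltac:(reg)); simp
  | |- context [nop ?x ?x] =>
    let r := rank x in
    rewrite (@nop_sqr_odd0 F V charF x ltac:(par) ltac:(reg)); simp
  | |- context [nop ?x (nop ?y ?w)] =>
    out_of_order x y;
    rewrite (@nop_swap F V _ _ x y _ w ltac:(par) ltac:(par) ltac:(scal)); simp
  | |- context [nop ?x ?y] =>
    out_of_order x y;
    rewrite (@nop_comm F V _ _ x y _ ltac:(par) ltac:(par) ltac:(scal)); simp
  end.

(** * Iterates of [ad A] on [Gplus] and on the numerator of [tauR_Gminus] *)

Let two_neq0 : (2 : F) != 0 := pchar0_natr_neq0 charF 1.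
Let six_neq0 : (6 : F) != 0 := pchar0_natr_neq0 charF 5.

Ltac nop_lincomb :=
  rewrite ?linE; repeat nop_step; lincomb F (va_space V);
  first [ring | by field; rewrite ?two_neq0 ?six_neq0].

(** In [k + 4], the [k] comes from [D jm], one 2 from quasi-associativity in [D u0 ** (um ** lm)],
    and the other 2 from [- der u0]. *)
Lemma ad_Gplus : D (Gplus g) =
  gm ** u0 ** (bt - X) - der u0 - up ** X - gm ** um ** jc + (k + 4) *: (der gm ** um)
  + 2 *: (gm ** der um).
Proof. rewrite /Gplus !adE /X; nop_lincomb. Qed.

Lemma ad2_Gplus : D (D (Gplus g)) =
  - 2 *: (gm ** gm ** um ** (bt - X)) + 4 *: (gm ** der um) - 2 *: (gm ** u0 ** X).
Proof. rewrite ad_Gplus /X !adE /X; nop_lincomb. Qed.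

(** Here [D] kills [gm], [um] and [X], and [D (bt - X) = - X]: the first term contributes 2, and
    [D u0] in the last contributes 4. The next iterate vanishes for the same reason. *)
Lemma ad3_Gplus : D (D (D (Gplus g))) = 6 *: (gm ** gm ** um ** X).
Proof. rewrite ad2_Gplus /X !adE /X; nop_lincomb. Qed.

Lemma ad4_Gplus : D (D (D (D (Gplus g)))) = 0.
Proof. rewrite ad3_Gplus /X !adE /X; nop_lincomb. Qed.

Definition Gminus_numerator : V :=
  lp ** (jm + (2 * kappa k) *: der gm) + l0 ** (j0 - jc + 2 *: (um ** lm))
  + lm ** (2 *: jp - bt) + u0 ** lp ** lm + 2 *: der l0.

Local Notation N := Gminus_numerator.

(** In the coefficient of [der gm ** lp] the contributions of [2 *: der l0] and of
    [D u0 ** (lp ** lm)] cancel, leaving [k] from [D jm]. Subtracted from the [2 * kappa] in the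
    numerator, it gives the [k + 4] of [Km]. *)
Lemma ad_Gminus : D N =
  gm ** lp ** jc + k *: (der gm ** lp) + 2 *: (gm ** l0 ** (X - bt)) + 2 *: der l0
  + lm ** X - 2 *: (gm ** der lp).
Proof. rewrite /N !adE /X; nop_lincomb. Qed.

Lemma ad2_Gminus : D (D N) =
  - 2 *: (gm ** gm ** lp ** (X - bt)) + 4 *: (gm ** l0 ** X) - 4 *: (gm ** der lp).
Proof. rewrite ad_Gminus /X !adE /X; nop_lincomb. Qed.

Lemma ad3_Gminus : D (D (D N)) = - 6 *: (gm ** gm ** lp ** X).
Proof. rewrite ad2_Gminus /X !adE /X; nop_lincomb. Qed.

Lemma ad4_Gminus : D (D (D (D N))) = 0.
Proof. rewrite ad3_Gminus /X !adE /X; nop_lincomb. Qed.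

(** * Invariance of [Jfield], [Phi] and [Tfield] *)

Lemma ad_Jfield : D (Jfield g) = 0.
Proof. rewrite /Jfield !adE /X; nop_lincomb. Qed.

Lemma ad_Phi : D (Phi k g) = 0.
Proof. rewrite /Phi !adE /X; nop_lincomb. Qed.

(** Of [4 * kappa k = 4 * k + 8], the part [4 * k] comes from the [k *: der gm] in [D jm], and the 8
    from quasi-associativity: 4 from [(gm ** j0) ** jp] and 4 from [(gm ** jp) ** j0]. *)
Lemma ad_Tfield_sl2 :
  D (j0 ** j0 + 2 *: (jp ** jm) + 2 *: (jm ** jp) - jc ** jc - 2 *: der jc) =
  (4 * kappa k) *: (der gm ** jp).
Proof. rewrite !adE /X /kappa; nop_lincomb. Qed.

Lemma ad_Tfield_fermions :
  D (der up ** lp + der u0 ** l0 + der um ** lm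
       - up ** der lp - u0 ** der l0 - um ** der lm) =
  2 *: (der gm ** (u0 ** lp - 2 *: (um ** l0))).
Proof.
rewrite !adE /X; nop_lincomb.
Qed.

Lemma ad_Tfield_betgam : D (bt ** der gm) = - (der gm ** X).
Proof.
(* [X] is kept whole: expanding it would create left-nested fermion words, which [nop_step] does not
   open. *)
have regX : regular gm X by rewrite /X; reg.
rewrite (ad_nop parity_Afield) (ad_der parity_Afield) ad_bt ad_gm der0 nop0r addr0.
by rewrite nopNl (nop_comm_der parity_gam parity_X regX).
Qed.

Hypothesis kappa_neq0 : kappa k != 0.

Lemma ad_Tfield : D (Tfield k g) = 0.
Proof.
have four_kappa_neq0 : 4 * kappa k != 0.
  by rewrite mulf_neq0 // (pchar0_natr_neq0 charF 3).
(* After division the three parts are [- (der gm ** X)], [der gm ** jp] and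
   [der gm ** (u0 ** lp - 2 *: (um ** l0))], which cancel by the definition of [X]. *)
rewrite /Tfield adD adD !adZ ad_Tfield_betgam ad_Tfield_sl2 ad_Tfield_fermions.
rewrite !scalerA !mulVf // !scale1r /X !linE.
by lincomb F (va_space V); ring.
Qed.

(** * Summation of the two exponential series *)

Lemma exp_ad_Gplus : exp_ad (Afield g) (-1) (Gplus g) =
  up ** (jp + Kp g) + u0 ** (2^-1 *: (j0 + K0 g) - up ** lp + um ** lm)
  + um ** (jm + Km k g) - 2 *: (up ** um ** l0).
Proof.
rewrite (exp_neg_ad_order4 erefl erefl erefl ad4_Gplus).
rewrite ad3_Gplus ad2_Gplus ad_Gplus /Gplus /Kp /K0 /Km /X; nop_lincomb.
Qed.

Lemma exp_ad_Gminus : exp_ad (Afield g) (-1) (tauR_Gminus k g) =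
  (2 * kappa k)^-1 *:
    (lp ** (jm - Km k g) + l0 ** (j0 - K0 g) + lm ** (jp - Kp g)).
Proof.
rewrite /tauR_Gminus -/N; set c := (2 * kappa k)^-1.
have D4 : D (D (D (D (c *: N)))) = 0 by rewrite !adZ ad4_Gminus scaler0.
rewrite (exp_neg_ad_order4 erefl erefl erefl D4) !adZ.
transitivity (c *: (N - D N + 2^-1 *: D (D N) - 6^-1 *: D (D (D N)))).
  by lincomb F (va_space V); ring.
congr (_ *: _); rewrite ad3_Gminus ad2_Gminus ad_Gminus.
rewrite /N /Kp /K0 /Km /X /kappa; nop_lincomb.
Qed.

(** * Nilpotency on the generators and conclusion *)

Lemma generated_Afield : generated (all_generators g) (Afield g).
Proof.
rewrite AfieldE /X -scaleNr -[jp]scale1r -addrA /all_generators.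
apply: generated_nprod; first by apply: generated_mem; mem.
apply: generated_linear; first by apply: generated_mem; mem.
by apply: generated_linear; apply: generated_nprod; apply: generated_mem; mem.
Qed.

Lemma generators_nilpotent :
  {in all_generators g, forall x, ad_nilpotent (Afield g) x}.
Proof.
(* The bound 3 serves all generators; the longest chains have the shape [up], [gm ** u0], a multiple
   of [gm ** gm ** um], 0. *)
move=> x; have nil3 : D (D (D x)) = 0 -> ad_nilpotent (Afield g) x by exists 3.
rewrite /all_generators /bosons /fermions /sl2_currents /lower_fermions
  /upper_fermions /= !inE => gx; apply: nil3.
by move: gx; do ![case/predU1P=> [->|]|move/eqP=> ->];
  rewrite ?(adE, linE) /X ?(adE, linE); nop_lincomb.
Qed.

End Wakimoto.

Theorem theorem7p1 (F : fieldType) (charF : [pchar F] =i pred0)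
    (k : F) (kappa_neq0 : kappa k != 0)
    (V : vertex_superalgebra F) (g : generators V)
    (hg : generator_opes k g) :
  exists phi : V -> V,
    [/\ forall x, generated (all_generators g) x ->
          exp_neg_ad_to (Afield g) x (phi x),
        automorphism_on (generated (all_generators g)) phi,
        phi (Gplus g) =
          aUp g ** (Jp g + Kp g)
          + aU0 g ** (2^-1 *: (J0 g + K0 g)
                      - aUp g ** aLp g + aUm g ** aLm g)
          + aUm g ** (Jm g + Km k g)
          - 2 *: (aUp g ** aUm g ** aL0 g),
        phi (tauR_Gminus k g) =
          (2 * kappa k)^-1 *:
            (aLp g ** (Jm g - Km k g)
             + aL0 g ** (J0 g - K0 g)
             + aLm g ** (Jp g - Kp g))
      & [/\ phi (Jfield g) = Jfield g,
            phi (Tfield k g) = Tfield k g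
          & phi (Phi k g) = Phi k g]].
Proof.
have A_even := parity_Afield hg.
have nil := generated_nilpotent A_even charF (generators_nilpotent charF hg).
exists (exp_ad (Afield g) (-1)); split.
- by move=> x /nil; exact: exp_neg_ad_toP.
- exact: exp_ad_automorphism (generated_Afield g) (generators_nilpotent charF hg) _.
- exact: exp_ad_Gplus.
- exact: exp_ad_Gminus.
- split; apply: exp_ad_fixed.
  + exact: (ad_Jfield charF hg).
  + exact: (ad_Tfield charF hg kappa_neq0).
  + exact: (ad_Phi charF hg).
Qed.
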